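(* Let $f$ be a cubic surface that has a singular point which is not an ordinary double point. Then $f$ lies on the Hessian discriminant.
   Context: A cubic surface is a nonzero homogeneous polynomial $f$ of degree $3$ in $x_1,\ldots,x_4$ with complex coefficients, considered up to scale and identified with its vanishing locus in $\mathbb{P}^3_{\mathbb{C}}$. A point $p\in\mathbb{P}^3$ is a singular point of $f$ if all partial derivatives of $f$ vanish at $p$; it is an ordinary double point (type $A_1$) if, in an affine chart with $p$ at the origin, the degree-two part of the local equation is a quadratic form of rank three. The Hessian matrix of $f$ is the symmetric $4\times 4$ matrix $\left(\partial^2 f/\partial x_i\partial x_j\right)$ of linear forms. For generic $f$, the locus in $\mathbb{P}^3$ where the Hessian matrix has rank at most two, defined by its $3\times3$ minors, consists of exactly 10 reduced points. The Hessian discriminant is the set of cubic surfaces $f$ for which this locus does not consist of 10 reduced points. *)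

(* Defs.v *)
From HB Require Import structures.
From mathcomp Require Import all_boot all_order all_algebra.
From mathcomp Require Import reals complex.
From mathcomp Require Export mpoly.

Set Implicit Arguments.
Unset Strict Implicit.
Unset Printing Implicit Defensive.

Import GRing.Theory.
Local Open Scope ring_scope.

Section HessianDiscriminant.
Variable K : fieldType.

(* A point of P^3 is given by homogeneous coordinates: a nonzero p : 'rV_4,
   up to same_point. *)
Definition same_point (p q : 'rV[K]_4) : Prop :=
  exists2 c : K, c != 0 & p = c *: q.

Definition cubic_surface (f : {mpoly K[4]}) : Prop :=
  f != 0 /\ f \is 3.-homog.

Definition singular_point (f : {mpoly K[4]}) (p : 'rV[K]_4) : Prop :=
  p != 0 /\ forall i : 'I_4, (f^`M(i)).@[p 0] = 0.

(* The equation of f in the chart x_i = 1 of P^3, translated so that p is the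
   origin: x_i = 1 and x_j = p_j / p_i + y_k when j is the k-th index other
   than i.  This is meaningful when p 0 i != 0. *)
Definition local_equation (f : {mpoly K[4]}) (p : 'rV[K]_4) (i : 'I_4) :
    {mpoly K[3]} :=
  f \mPo [tuple if unlift i j is Some k then (p 0 j / p 0 i)%:MP + 'X_k else 1
         | j < 4].

(* The symmetric matrix Q with q(y) = y Q y^T, for q a quadratic form in
   characteristic other than 2. *)
Definition qform_mx n (q : {mpoly K[n]}) : 'M[K]_n :=
  \matrix_(i, j) if i == j then q@_(U_(i) *+ 2) else q@_(U_(i) + U_(j)) / 2%:R.

Definition ordinary_double_point (f : {mpoly K[4]}) (p : 'rV[K]_4) : Prop :=
  singular_point f p /\
  exists2 i : 'I_4, p 0 i != 0 &
    \rank (qform_mx (pihomog mdeg 2 (local_equation f p i))) = 3%N.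

Definition hessian (f : {mpoly K[4]}) : 'M[{mpoly K[4]}]_4 :=
  \matrix_(i, j) f^`M(i)^`M(j).

(* The set of points underlying the locus; its scheme structure is given by
   hessian_minors_ideal. *)
Definition hessian_locus (f : {mpoly K[4]}) (p : 'rV[K]_4) : Prop :=
  p != 0 /\ (\rank (map_mx (meval (p 0%R)) (hessian f)) <= 2)%N.

(* A 3 x 3 submatrix of a 4 x 4 matrix omits one row and one column. *)
Definition hessian_minor (f : {mpoly K[4]}) (i j : 'I_4) : {mpoly K[4]} :=
  \det (row' i (col' j (hessian f))).

Definition hessian_minors_ideal (f g : {mpoly K[4]}) : Prop :=
  exists a : 'I_4 -> 'I_4 -> {mpoly K[4]},
    g = \sum_(i < 4) \sum_(j < 4) a i j * hessian_minor f i j.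

(* The scheme Proj (K[x_1..x_4] / I), with I the ideal of the minors, is the
   reduced point Spec K near p: its local ring at p, which is the degree 0 part
   of the localization of K[x_1..x_4] / I at the homogeneous ideal of p, is the
   residue field.  That is, its maximal ideal vanishes: every form g with
   g(p) = 0 is killed by some form u with u(p) != 0. *)
Definition reduced_point_of_hessian_locus (f : {mpoly K[4]}) (p : 'rV[K]_4) :
    Prop :=
  hessian_locus f p /\
  forall (d : nat) (g : {mpoly K[4]}), g \is d.-homog -> g.@[p 0] = 0 ->
    exists (e : nat) (u : {mpoly K[4]}),
      [/\ u \is e.-homog, u.@[p 0] != 0 & hessian_minors_ideal f (u * g)].

Definition hessian_locus_is_10_reduced_points (f : {mpoly K[4]}) : Prop :=
  exists s : 'I_10 -> 'rV[K]_4,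
    [/\ forall k, reduced_point_of_hessian_locus f (s k),
        forall k l, same_point (s k) (s l) -> k = l
      & forall p, hessian_locus f p -> exists k, same_point p (s k)].

Definition hessian_discriminant (f : {mpoly K[4]}) : Prop :=
  cubic_surface f /\ ~ hessian_locus_is_10_reduced_points f.

End HessianDiscriminant.

(* Main.v *)
Require Import Defs.
From HB Require Import structures.
From mathcomp Require Import all_boot all_order all_algebra ring zify.
From mathcomp Require Import reals complex.

(** Let F be the symmetric trilinear form attached to the cubic f, so that the
    Hessian matrix at x is F(x, -, -).  If p is a singular point, then by
    Euler's identity F(p, p, -) = 0, that is, the Hessian at p kills p
    ([singular_point_hessian]).  In the chart around p, the quadratic part of f
    is, up to a nonzero scalar, the quadratic form that the Hessian at p induces
    modulo p ([local_qform_mx]).  If p is not an ordinary double point, this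
    form is degenerate, and the Hessian at p kills a second vector k, independent of
    p ([nonordinary_hessian_kernel]).  So the Hessian has rank at most 2 at p,
    and p belongs to the Hessian locus.

    It remains to see that p is not a reduced point of this locus, by
    finding a tangent vector v that is not a multiple of p.  A symmetric pencil
    A + X B has all its minors of corank one divisible by X^2 when A kills a
    plane on which the form B is zero ([minor_pencil_dvdX2]).  With
    A = F(p, -, -), B = F(v, -, -) and the plane spanned by p and k, the values
    F(v, p, p) and F(v, p, k) vanish already, and only F(v, k, k) = 0 is left.
    This is one linear condition on v in a space of dimension 4
    ([exists_tangent_direction]).  Hence the ideal of the minors restricts to
    multiples of X^2 on the line p + X v, which contradicts reducedness
    ([kernel_plane_not_reduced]). *)

Set Implicit Arguments.
Unset Strict Implicit.
Unset Printing Implicit Defensive.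

Import GRing.Theory.
Local Open Scope ring_scope.

(** * Determinants of pencils of matrices modulo X^2 *)

Section Pencil.
Variable K : fieldType.

Definition pencil m n (A B : 'M[K]_(m, n)) : 'M[{poly K}]_(m, n) :=
  map_mx polyC A + 'X *: map_mx polyC B.

(** Each entry of [r *m \adj A] is, by Laplace expansion, the determinant of
    [A] with one row replaced by [r]; such a matrix still kills [z]. *)
Lemma mul_adj_row_eq0 n (A : 'M[K]_n) (r : 'rV[K]_n) (z : 'cV[K]_n) :
  z != 0 -> A *m z = 0 -> r *m z = 0 -> r *m \adj A = 0.
Proof.
move=> z0 Az rz; apply/rowP => a; rewrite [RHS]mxE.
pose A' : 'M_n := \matrix_(i, j) if i == a then r 0 j else A i j.
have -> : (r *m \adj A) 0 a = \det A'.
  rewrite (expand_det_row _ a) mxE; apply: eq_bigr => j _.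
  rewrite !mxE eqxx /cofactor; congr (_ * (_ * \det _)).
  by apply/matrixP => k l; rewrite !mxE eq_sym (negbTE (neq_lift _ _)).
have A'z : A' *m z = 0.
  apply/colP => i; rewrite mxE [RHS]mxE.
  have [ia|ia] := eqVneq i a.
    transitivity ((r *m z) 0 0); last by rewrite rz mxE.
    by rewrite mxE; apply: eq_bigr => j _; rewrite mxE ia eqxx.
  transitivity ((A *m z) i 0); last by rewrite Az mxE.
  by rewrite mxE; apply: eq_bigr => j _; rewrite mxE (negbTE ia).
apply/eqP; rewrite -det_tr; apply/det0P; exists z^T; first by rewrite trmx_eq0.
by rewrite -trmx_mul A'z trmx0.
Qed.

(** Jacobi's formula gives the coefficient of X as the trace of [\adj A *m B],
    and [\adj A] is a multiple of [z *m w] as soon as both kernels are lines.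
    The argument below avoids distinguishing ranks: [w *m (A + X B)] is
    divisible by X, which yields one factor X, and the cofactor left over
    vanishes at X = 0 by [mul_adj_row_eq0]. *)
Lemma det_pencil_dvdX2 n (A B : 'M[K]_n) (w : 'rV[K]_n) (z : 'cV[K]_n) :
  w != 0 -> z != 0 -> w *m A = 0 -> A *m z = 0 -> w *m B *m z = 0 ->
  'X^2 %| \det (pencil A B).
Proof.
move=> w0 z0 wA Az wBz.
have [a wa] : exists a, w 0 a != 0 by apply/rV0Pn.
set D := pencil A B; pose P m n := @map_mx _ _ (@polyC K) m n.
have wD : P _ _ w *m D = 'X *: P _ _ (w *m B).
  by rewrite /D /pencil mulmxDr -scalemxAr -!map_mxM wA map_mx0 add0r.
have Da : (w 0 a) *: \det D = 'X * (P _ _ (w *m B) *m \adj D) 0 a.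
  have: P _ _ w *m D *m \adj D = 'X *: (P _ _ (w *m B) *m \adj D).
    by rewrite wD -scalemxAl.
  rewrite -mulmxA mul_mx_adj mul_mx_scalar => /rowP/(_ a).
  by rewrite !mxE => <-; rewrite mulrC mul_polyC.
rewrite -(dvdpZr _ _ wa) Da exprS expr1 dvdp_mul2l ?polyX_eq0 //.
rewrite -['X]subr0 -polyC0 dvdp_XsubCl; apply/eqP.
have D0 : map_mx (horner_eval 0) D = A.
  by apply/matrixP => i j; rewrite !mxE /horner_eval !hornerE.
have Q0 : map_mx (horner_eval 0) (P _ _ (w *m B) *m \adj D) = 0.
  rewrite map_mxM map_mx_adj D0 -[RHS](mul_adj_row_eq0 z0 Az wBz).
  by congr (_ *m _); apply/rowP => j; rewrite /P !mxE /= /horner_eval hornerC.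
by have := congr1 (fun M : 'rV_n => M 0 a) Q0; rewrite !mxE.
Qed.

(** A single linear condition on a plane leaves at least a line. *)
Lemma exists_row_vanishing_at n (U : 'M[K]_(2, n)) (i : 'I_n) :
  row_free U -> exists2 a : 'rV[K]_2, a *m U != 0 & (a *m U) 0 i = 0.
Proof.
move=> freeU.
have ker0 : kermx (col i U) != 0.
  rewrite -mxrank_eq0 mxrank_ker subn_eq0 -ltnNge.
  by apply: leq_ltn_trans (rank_leq_col _) _.
have /rowV0Pn[a /sub_kermxP aU a0] := ker0.
exists a; first by rewrite mulmx_free_eq0.
have /rowP/(_ 0) := aU; rewrite !mxE => aUi; rewrite -[RHS]aUi.
by apply: eq_bigr => j _; rewrite mxE.
Qed.

Lemma mulmx_row'E m n (x : 'rV[K]_n.+1) (A : 'M[K]_(n.+1, m)) i :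
  x 0 i = 0 -> col' i x *m row' i A = x *m A.
Proof.
move=> xi; apply/rowP => j; rewrite !mxE (bigD1_ord i) //= xi mul0r add0r.
by apply: eq_bigr => l _; rewrite !mxE.
Qed.

(** If the symmetric matrix [A] kills the plane [U] and [U] is isotropic for
    [B], then [A + X B] has rank at most [n - 1] to first order.  For the minor
    omitting row [i] and column [j], the vectors required by [det_pencil_dvdX2]
    are those of [U] with a zero at [i], respectively at [j]: dropping that
    coordinate loses nothing. *)
Lemma minor_pencil_dvdX2 n (A B : 'M[K]_n.+1) (U : 'M[K]_(2, n.+1)) i j :
  row_free U -> A^T = A -> U *m A = 0 -> U *m B *m U^T = 0 ->
  'X^2 %| \det (row' i (col' j (pencil A B))).
Proof.
move=> freeU symA UA UBU.
have [a aU ai] := exists_row_vanishing_at i freeU.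
have [b bU bj] := exists_row_vanishing_at j freeU.
have col'0 (x : 'rV[K]_n.+1) l : x 0 l = 0 -> x != 0 -> col' l x != 0.
  move=> xl; apply: contra => /eqP h; apply/eqP/rowP => s; rewrite mxE.
  have [t ->|->//] := unliftP l s.
  by move/rowP/(_ t): h; rewrite !mxE.
have -> : row' i (col' j (pencil A B))
    = pencil (row' i (col' j A)) (row' i (col' j B)).
  by apply/matrixP => s t; rewrite !mxE.
have wC (x : 'rV[K]_n.+1) (C : 'M[K]_n.+1) s t : x 0 s = 0 ->
    col' s x *m row' s (col' t C) = col' t (x *m C).
  move=> xi; rewrite mulmx_row'E //; apply/rowP => q; rewrite !mxE.
  by apply: eq_bigr => l _; rewrite mxE.
have Cz (x : 'rV[K]_n.+1) : col' j x *m (col' j (b *m U))^T = x *m (b *m U)^T.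
  apply: trmx_inj; rewrite !trmx_mul !trmxK tr_col'.
  by rewrite mulmx_row'E.
apply: (@det_pencil_dvdX2 _ _ _ (col' i (a *m U)) (col' j (b *m U))^T).
- exact: col'0.
- by rewrite trmx_eq0; apply: col'0.
- by rewrite wC // -mulmxA UA mulmx0; apply/matrixP => s t; rewrite !mxE.
- apply: trmx_inj; rewrite trmx_mul trmxK trmx0.
  have -> : (row' i (col' j A))^T = row' j (col' i A).
    by rewrite -[in RHS]symA; apply/matrixP => s t; rewrite !mxE.
  by rewrite wC // -mulmxA UA mulmx0; apply/matrixP => s t; rewrite !mxE.
- rewrite wC // Cz trmx_mul -!mulmxA (mulmxA B) (mulmxA U).
  by rewrite (mulmxA U) UBU mul0mx mulmx0.
Qed.

End Pencil.

(** * Derivatives and coefficients of multivariate polynomials *)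

Section Homogeneous.
Variables (R : comNzRingType) (n : nat).
Implicit Types f g : {mpoly R[n]}.

Lemma dhomog_mderiv d f i : f \is d.+1.-homog -> f^`M(i) \is d.-homog.
Proof.
move=> hf; apply/dhomogP => m; rewrite mcoeff_msupp mcoeff_deriv => nz.
apply/eqP; rewrite -eqSS; apply: contraNT nz => hm.
by rewrite (dhomog_nemf_coeff hf) ?mul0rn //= mdegD mdeg1 addn1.
Qed.

Lemma dhomog1E g : g \is 1.-homog -> g = \sum_k g@_U_(k) *: 'X_k.
Proof.
move=> hg; apply/mpolyP => m; rewrite raddf_sum /=.
have [/mdeg1P[k /eqP ->]|dm] := boolP (mdeg m == 1%N).
  rewrite (bigD1 k) //= mcoeffZ mcoeffXU eqxx mulr1 big1 ?addr0 // => l lk.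
  by rewrite mcoeffZ mcoeffXU (negbTE lk) mulr0.
rewrite (dhomog_nemf_coeff hg) // big1 // => k _.
rewrite mcoeffZ mcoeffX; case: eqP => [e|]; last by rewrite mulr0.
by rewrite -e mdeg1 in dm.
Qed.

Lemma euler d f : f \is d.-homog -> \sum_i 'X_i * f^`M(i) = d%:R *: f.
Proof.
move=> /dhomogP hf; rewrite [in RHS](mpolyE f) scaler_sumr.
under eq_bigr => i _ do rewrite {1}(mpolyE f) raddf_sum mulr_sumr.
rewrite exchange_big /= !big_seq; apply: eq_bigr => m /hf dm.
transitivity (\sum_(i < n) (m i)%:R *: (f@_m *: 'X_[m] : {mpoly R[n]})).
  apply: eq_bigr => i _; rewrite mderivZ mderivX.
  have [->|mi] := posnP (m i); first by rewrite !scale0r scaler0 mulr0.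
  rewrite -!mul_mpolyC 2!['X_i * _]mulrCA -mpolyXD mulrCA.
  by rewrite addmC submK // lep1mP -lt0n.
by rewrite -scaler_suml -natr_sum -mdegE dm.
Qed.

End Homogeneous.

(** The chain rule: the identity holds for constants and variables and is
    stable under products and linear combinations. *)
Lemma mderiv_comp (R : comNzRingType) n k (f : {mpoly R[n]})
    (T : n.-tuple {mpoly R[k]}) a :
  (f \mPo T)^`M(a) = \sum_i (f^`M(i) \mPo T) * (tnth T i)^`M(a).
Proof.
pose chain g := (g \mPo T)^`M(a) = \sum_i (g^`M(i) \mPo T) * (tnth T i)^`M(a).
have chainM g h : chain g -> chain h -> chain (g * h).
  rewrite /chain rmorphM mderivM => -> ->.
  rewrite mulr_suml mulr_sumr -big_split.
  apply: eq_bigr => i _ /=; rewrite mderivM rmorphD !rmorphM /=; ring.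
have chain1 : chain 1.
  rewrite /chain rmorph1 -mpolyC1 mderivC big1 // => i _.
  by rewrite -mpolyC1 mderivC rmorph0 mul0r.
have chainX i : chain 'X_i.
  rewrite /chain comp_mpolyXU -tnth_nth (bigD1 i) //= big1 => [|j ji].
    rewrite addr0 mderivX mnm1E eqxx scale1r -[X in (X - _)%MM]add0m addmK.
    by rewrite mpolyX0 rmorph1 mul1r.
  by rewrite mderivX mnm1E eq_sym (negbTE ji) scale0r rmorph0 mul0r.
rewrite -/(chain f); elim/mpolyind: f => [|c m g _ _ IH].
  rewrite /chain rmorph0 mderiv0 big1 // => i _.
  by rewrite mderiv0 rmorph0 mul0r.
have chainm : chain 'X_[m].
  rewrite mpolyXE_id; elim/big_rec: _ => // i h _ ih; apply: (chainM) ih.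
  by elim: (m i) => // e ihe; rewrite exprS; apply: (chainM) ihe.
rewrite /chain comp_mpolyD comp_mpolyZ mderivD mderivZ IH chainm.
rewrite scaler_sumr -big_split; apply: eq_bigr => i _ /=.
by rewrite mderivD mderivZ comp_mpolyD comp_mpolyZ scalerAl mulrDl.
Qed.

Lemma mcoeff_pihomog (R : comNzRingType) n d (q : {mpoly R[n]}) m :
  mdeg m = d -> (pihomog mdeg d q)@_m = q@_m.
Proof.
move=> dm; elim/mpolyind: q => [|c k q _ _ IH]; first by rewrite raddf0.
rewrite raddfD /= linearZ /= pihomogX !mcoeffD IH !mcoeffZ; congr (_ * _ + _).
case: ifPn => // dk; rewrite mcoeff0 mcoeffX; case: eqP => // km.
by move: dk; rewrite km /= dm eqxx.
Qed.

Lemma mcoeff0_meval (R : comNzRingType) n (q : {mpoly R[n]}) :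
  q@_0 = q.@[fun=> 0].
Proof.
elim/mpolyind: q => [|c m q _ _ IH]; first by rewrite !raddf0.
rewrite mcoeffD IH mcoeffZ mevalD mevalZ; congr (_ * _ + _).
rewrite mcoeffX mevalX; have [->|/eqP m0] := eqVneq m 0%MM.
  by rewrite big1 // => i _; rewrite mnm0E.
have [i mi] : exists i, m i != 0%N.
  apply/existsP; apply: contraPT m0; rewrite negb_exists => /forallP m0; apply.
  by apply/mnmP => i; rewrite mnm0E; apply/eqP; move: (m0 i); rewrite negbK.
by rewrite (bigD1 i) //= expr0n (negbTE mi) mul0r.
Qed.

(** Second derivatives double the coefficients of squares but not those of
    mixed monomials; the matrix of a quadratic form compensates for this by
    halving the mixed coefficients. *)
Lemma qform_mx_pihomog (K : fieldType) n (q : {mpoly K[n]}) a b :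
  (2%:R : K) != 0 ->
  2%:R * qform_mx (pihomog mdeg 2 q) a b = q^`M(a)^`M(b).@[fun=> 0].
Proof.
move=> two0; rewrite -mcoeff0_meval !mcoeff_deriv mxE add0m mnm0E mulr1n mnm1E.
have [->|ab] := eqVneq a b.
  rewrite mcoeff_pihomog; last by rewrite mdegMn mdeg1.
  by rewrite mulr_natl mulr2n.
rewrite mcoeff_pihomog ?mdegD ?mdeg1 // mulrC divfK //.
by rewrite addmC.
Qed.

(** * Restriction of forms to a line *)

Section RestrictLine.
Variables (K : fieldType) (n : nat).
Implicit Types (p v : 'rV[K]_n) (g : {mpoly K[n]}).

Definition restrict_line p v : {mpoly K[n]} -> {poly K} :=
  mmap (@polyC K) (fun k => pencil p v 0 k).

HB.instance Definition _ p v := GRing.RMorphism.copy (restrict_line p v)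
  (mmap (@polyC K) (fun k => pencil p v 0 k)).

Lemma restrict_line_dhomog1 p v g :
  g \is 1.-homog ->
  restrict_line p v g = (g.@[p 0])%:P + 'X * (g.@[v 0])%:P.
Proof.
move=> /dhomog1E g1.
have [c ->] : exists c, g = \sum_k c k *: 'X_k by exists (fun k => g@_U_(k)).
have evalE (x : 'I_n -> K) : (\sum_k c k *: 'X_k).@[x] = \sum_k c k * x k.
  by rewrite raddf_sum; apply: eq_bigr => k _; rewrite /= mevalZ mevalXU.
rewrite !evalE /restrict_line raddf_sum !rmorph_sum mulr_sumr -big_split.
apply: eq_bigr => k _ /=.
by rewrite mmapZ mmapX mmap1U !mxE !polyCM mulrDr mulrCA.
Qed.

Lemma horner_restrict_line0 p v g : (restrict_line p v g).[0] = g.@[p 0].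
Proof.
rewrite /restrict_line.
elim/mpolyind: g => [|c m g _ _ IH]; first by rewrite !raddf0 horner0.
rewrite raddfD /= hornerD IH mevalD mmapZ mevalZ hornerM hornerC.
rewrite mmapX mevalX horner_prod; congr (_ * _ + _); apply: eq_bigr => i _.
by rewrite horner_exp !mxE !hornerE.
Qed.

End RestrictLine.

(** * The Hessian of a cubic form *)

Section Cubic.
Variables (K : fieldType) (f : {mpoly K[4]}).
Hypothesis cubic : f \is 3.-homog.
Implicit Types p v x y : 'rV[K]_4.

Definition hessian_at x : 'M[K]_4 := map_mx (meval (x 0)) (hessian f).

(** The Hessian is given by the constant third derivatives of the cubic, that
    is, by a symmetric trilinear form F with [y *m hessian_at x *m z^T] equal to
    F(x, y, z). *)
Lemma hessian_atE x i j :
  hessian_at x i j = \sum_k x 0 k * (f^`M(i)^`M(j)^`M(k))@_0.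
Proof.
have h1 : f^`M(i)^`M(j) \is 1.-homog by do 2!apply: dhomog_mderiv.
rewrite !mxE [in LHS](dhomog1E h1) raddf_sum; apply: eq_bigr => k _ /=.
by rewrite mevalZ mevalXU mulrC [in RHS]mcoeff_deriv add0m mnm0E mulr1n.
Qed.

Lemma hessian_at_sym x : (hessian_at x)^T = hessian_at x.
Proof. by apply/matrixP => i j; rewrite !mxE mderiv_comm. Qed.

Lemma hessian_at_scale c x : hessian_at (c *: x) = c *: hessian_at x.
Proof.
apply/matrixP => i j; rewrite [RHS]mxE !hessian_atE mulr_sumr.
by apply: eq_bigr => k _; rewrite mxE mulrA.
Qed.

(** The symmetry F(y, x, -) = F(x, y, -) of the trilinear form. *)
Lemma mul_hessian_atC x y : x *m hessian_at y = y *m hessian_at x.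
Proof.
apply/rowP => j; rewrite mxE [RHS]mxE.
under eq_bigr do rewrite hessian_atE mulr_sumr.
under [RHS]eq_bigr do rewrite hessian_atE mulr_sumr.
rewrite exchange_big; apply: eq_bigr => k _; apply: eq_bigr => i _.
rewrite mulrCA; congr (_ * (_ * _@__)).
by rewrite (mderiv_comm j k) (mderiv_comm i k) (mderiv_comm i j).
Qed.

Lemma euler_hessian x j : (x *m hessian_at x) 0 j = 2%:R * (f^`M(j)).@[x 0].
Proof.
have h2 : f^`M(j) \is 2.-homog by apply: dhomog_mderiv.
rewrite -mevalZ -(euler h2) raddf_sum mxE; apply: eq_bigr => i _ /=.
by rewrite mxE mevalM mevalXU mxE mderiv_comm.
Qed.

Lemma restrict_hessian p v :
  map_mx (restrict_line p v) (hessian f)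
  = pencil (hessian_at p) (hessian_at v).
Proof.
apply/matrixP => i j.
have h1 : f^`M(i)^`M(j) \is 1.-homog by do 2!apply: dhomog_mderiv.
by rewrite mxE [hessian f i j]mxE restrict_line_dhomog1 // !mxE.
Qed.

(** The point [p + X v] satisfies the equations of the Hessian locus modulo
    X^2, in other words [v] is tangent to the locus at [p].  Among the values
    F(v, x, y) for x and y among [p] and [k], all those that involve [p]
    vanish since F(p, p, -) = F(p, k, -) = 0; the remaining one is the condition
    F(v, k, k) = 0. *)
Lemma restrict_minors_ideal p v (k : 'rV[K]_4) h :
  p != 0 -> ~~ (k <= p)%MS -> p *m hessian_at p = 0 -> k *m hessian_at p = 0 ->
  v *m hessian_at k *m k^T = 0 -> hessian_minors_ideal f h ->
  'X^2 %| restrict_line p v h.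
Proof.
move=> p0 kp pH kH vk [a ->].
have freeU : row_free (col_mx p k).
  rewrite /row_free eqn_leq rank_leq_row -addsmxE.
  have lt_p : (p < p + k)%MS by rewrite ltmxE addsmxSl addsmx_sub submx_refl.
  by have := rank_ltmx lt_p; rewrite rank_rV p0.
have dvd_sum (F : 'I_4 -> {poly K}) :
    (forall i, 'X^2 %| F i) -> 'X^2 %| \sum_i F i.
  by move=> dvdF; elim/big_rec: _ => [|i q _]; [apply: dvdp0 | apply: dvdp_add].
rewrite raddf_sum; apply: (dvd_sum _) => i.
rewrite raddf_sum; apply: (dvd_sum _) => j.
rewrite /= rmorphM; apply: dvdp_mull.
rewrite /hessian_minor -det_map_mx map_row' map_col' restrict_hessian.
have Hp x : x *m hessian_at p = 0 -> hessian_at p *m x^T = 0.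
  by move=> xH; rewrite -(hessian_at_sym p) -trmx_mul xH trmx0.
have Hk : hessian_at k *m p^T = 0.
  by rewrite -(hessian_at_sym k) -trmx_mul mul_hessian_atC kH trmx0.
have UH : col_mx p k *m hessian_at p = 0 by rewrite mul_col_mx pH kH col_mx0.
have UHU : col_mx p k *m hessian_at v *m (col_mx p k)^T = 0.
  rewrite mul_col_mx 2!(mul_hessian_atC _ v) tr_col_mx mul_col_row vk.
  by rewrite -!mulmxA !Hp // Hk !mulmx0 block_mx0.
exact: minor_pencil_dvdX2 freeU (hessian_at_sym p) UH UHU.
Qed.

(** The condition F(v, k, k) = 0 is a single linear equation in four unknowns,
    so its solutions cannot all be multiples of [p]. *)
Lemma exists_tangent_direction p (k : 'rV[K]_4) :
  exists2 v : 'rV[K]_4, ~~ (v <= p)%MS & v *m hessian_at k *m k^T = 0.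
Proof.
pose c := hessian_at k *m k^T.
have : ~~ (kermx c <= p)%MS.
  apply/negP => /mxrankS; rewrite mxrank_ker leqNgt.
  move: (rank_leq_col c) (rank_leq_row p).
  by case: (\rank c) => [|[|]]; case: (\rank p) => [|[|]].
case/row_subPn => i vp; exists (row i (kermx c)) => //.
by rewrite -mulmxA -row_mul mulmx_ker row0.
Qed.

(** A linear form [g] that vanishes at [p] and not at the tangent vector [v]
    restricts to a nonzero multiple of X on the line, so a form [u] with
    [u(p) != 0] cannot bring [u * g] into the ideal, whose members restrict to
    multiples of X^2. *)
Lemma kernel_plane_not_reduced p (k : 'rV[K]_4) :
  p != 0 -> ~~ (k <= p)%MS -> p *m hessian_at p = 0 -> k *m hessian_at p = 0 ->
  ~ reduced_point_of_hessian_locus f p.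
Proof.
move=> p0 kp pH kH [_ red].
have [v vp vk] := exists_tangent_direction p k.
have [j gv] : exists j, (v *m cokermx p) 0 j != 0.
  by apply/rV0Pn; rewrite -submxE.
(* Column j of the cokernel of p gives a linear form that vanishes at p. *)
pose g : {mpoly K[4]} := \sum_k (cokermx p) k j *: 'X_k.
have g1 : g \is 1.-homog.
  by apply: rpred_sum => l _; apply: rpredZ; rewrite dhomogX /= mdeg1.
have gE x : g.@[x 0] = (x *m cokermx p) 0 j.
  rewrite raddf_sum mxE; apply: eq_bigr => l _ /=.
  by rewrite mevalZ mevalXU mulrC.
have gp : g.@[p 0] = 0 by rewrite gE mulmx_coker mxE.
have [e [u [_ up ug]]] := red _ _ g1 gp.
have := restrict_minors_ideal p0 kp pH kH vk ug.
rewrite rmorphM /= (restrict_line_dhomog1 _ _ g1) gp add0r mulrCA expr2.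
rewrite dvdp_mul2l ?polyX_eq0 // -['X]subr0 -polyC0 dvdp_XsubCl rootE hornerM.
by rewrite hornerC horner_restrict_line0 gE mulf_eq0 (negbTE up) (negbTE gv).
Qed.

End Cubic.

(** * Singular points that are not ordinary double points *)

Section NonOrdinary.
Variables (K : fieldType) (f : {mpoly K[4]}) (p : 'rV[K]_4).
Hypotheses (two_neq0 : (2%:R : K) != 0) (cubic : f \is 3.-homog).
Hypothesis sing : singular_point f p.

Lemma singular_point_hessian : p *m hessian_at f p = 0.
Proof.
by apply/rowP => j; rewrite euler_hessian // (proj2 sing) mulr0 mxE.
Qed.

(** The chart [x_i = 1] sends the origin to [p / p_i], and its derivative is
    the inclusion of the coordinates other than [i].  By the chain rule the
    local Hessian is therefore a submatrix of the Hessian at [p / p_i]. *)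
Lemma local_qform_mx i : p 0 i != 0 ->
  (2%:R * p 0 i) *: qform_mx (pihomog mdeg 2 (local_equation f p i))
  = row' i (col' i (hessian_at f p)).
Proof.
move=> pi0; rewrite mulrC -scalerA; apply/matrixP => a b.
rewrite mxE [(_ *: qform_mx _) a b]mxE qform_mx_pihomog // /local_equation.
set T := [tuple _ | j < 4].
have dT c j : (tnth T j)^`M(c) = (j == lift i c)%:R.
  rewrite tnth_mktuple; case: unliftP => [l ->|->].
    rewrite mderivD mderivC add0r mderivX mnm1E (inj_eq lift_inj).
    case: eqVneq => [->|_]; last by rewrite scale0r.
    by rewrite scale1r -[X in (X - _)%MM]add0m addmK mpolyX0.
  by rewrite -mpolyC1 mderivC (negbTE (neq_lift _ _)).
have dcomp (g : {mpoly K[4]}) c : (g \mPo T)^`M(c) = g^`M(lift i c) \mPo T.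
  rewrite mderiv_comp (bigD1 (lift i c)) //= dT eqxx mulr1.
  by rewrite big1 ?addr0 // => j jc; rewrite dT (negbTE jc) mulr0.
rewrite !dcomp comp_mpoly_meval.
have T0 j : (tnth T j).@[fun=> 0] = ((p 0 i)^-1 *: p) 0 j.
  rewrite tnth_mktuple [RHS]mxE [RHS]mulrC; case: unliftP => [l ->|->].
    by rewrite mevalD mevalC mevalXU addr0.
  by rewrite meval1 divff.
rewrite (meval_eq _ T0).
have /matrixP/(_ (lift i a) (lift i b)) := hessian_at_scale cubic (p 0 i)^-1 p.
by rewrite !mxE => ->; rewrite mulrA divff ?mul1r.
Qed.

(** A degenerate quadratic part kills some [y]; extending [y] by a zero at [i]
    gives [k].  The Hessian sends [k] to a vector supported at [i], and this
    vector is orthogonal to [p] because the Hessian is symmetric and kills [p];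
    as [p_i] is nonzero, it vanishes. *)
Lemma nonordinary_hessian_kernel :
  ~ ordinary_double_point f p ->
  exists2 k : 'rV[K]_4, ~~ (k <= p)%MS & k *m hessian_at f p = 0.
Proof.
move=> nodp; have /rV0Pn[i pi0] := proj1 sing.
have : \det (row' i (col' i (hessian_at f p))) == 0.
  rewrite -local_qform_mx // detZ mulf_eq0; apply/orP; right.
  apply: contraPT nodp => detQ nodp; apply: nodp; split=> //; exists i => //.
  by apply: mxrank_unit; rewrite unitmxE unitfE.
case/det0P => y y0 yH.
pose k : 'rV[K]_4 := \row_j if unlift i j is Some l then y 0 l else 0.
have ki : k 0 i = 0 by rewrite mxE unlift_none.
have k'y : col' i k = y by apply/rowP => l; rewrite !mxE liftK.
exists k.
  apply: contra y0 => /sub_rVP[c kc]; rewrite -k'y kc.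
  have /eqP : c * p 0 i = 0 by rewrite -ki kc mxE.
  rewrite mulf_eq0 (negbTE pi0) orbF => /eqP ->.
  by apply/eqP/rowP => l; rewrite scale0r !mxE.
have kHl l : (k *m hessian_at f p) 0 (lift i l) = 0.
  have := mulmx_row'E (col' i (hessian_at f p)) ki; rewrite k'y yH.
  move=> /rowP/(_ l); rewrite [LHS]mxE => h; rewrite [RHS]h !mxE.
  by apply: eq_bigr => j _; rewrite !mxE.
apply/rowP => j; rewrite [RHS]mxE; have [l ->//|->] := unliftP i j.
have kHp : k *m hessian_at f p *m p^T = 0.
  rewrite -mulmxA -(hessian_at_sym f p) -trmx_mul singular_point_hessian.
  by rewrite trmx0 mulmx0.
move/rowP/(_ 0): kHp; rewrite [LHS]mxE [RHS]mxE (bigD1_ord i) //= big1 ?addr0.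
  by move/eqP; rewrite [p^T _ _]mxE mulf_eq0 (negbTE pi0) orbF => /eqP.
by move=> l _; rewrite kHl mul0r.
Qed.

(** With [p] and [k] in the kernel, the Hessian has rank at most 2 at [p], so
    [p] is proportional to one of the ten points.  The hypotheses on [p] are
    invariant under scaling, hence apply to that representative. *)
Lemma nonordinary_hessian_discriminant :
  f != 0 -> ~ ordinary_double_point f p -> hessian_discriminant f.
Proof.
move=> f0 nodp; split=> // -[s [red _ cover]].
have p0 := proj1 sing; have pH := singular_point_hessian.
have [k kp kH] := nonordinary_hessian_kernel nodp.
have [|m [c c0 pc]] := cover p.
  split=> //; have : (col_mx p k <= kermx (hessian_at f p))%MS.
    by rewrite sub_kermx mul_col_mx pH kH col_mx0.
  move/mxrankS; rewrite mxrank_ker -addsmxE.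
  have lt_p : (p < p + k)%MS by rewrite ltmxE addsmxSl addsmx_sub submx_refl.
  move: (rank_ltmx lt_p); rewrite rank_rV p0 -/(hessian_at f p).
  by case: (\rank (hessian_at f p)) => [|[|[|[|[|]]]]] // *; lia.
have cH x : x *m hessian_at f p = 0 -> x *m hessian_at f (s m) = 0.
  rewrite pc hessian_at_scale // -scalemxAr => /eqP.
  by rewrite scaler_eq0 (negbTE c0) => /eqP.
have sp : (p :=: s m)%MS by rewrite pc; apply: eqmx_scale.
apply: (@kernel_plane_not_reduced _ _ cubic (s m) k) (red m).
- by apply: contraNneq p0 => s0; rewrite pc s0 scaler0.
- by rewrite -sp.
- apply: cH; move/eqP: pH; rewrite {1}pc -scalemxAl scaler_eq0 (negbTE c0).
  by move/eqP.
- exact: cH.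
Qed.

End NonOrdinary.

Theorem proposition4p1 (R : realType) (f : {mpoly (complex R)[4]})
    (p : 'rV[complex R]_4) :
  cubic_surface f -> singular_point f p -> ~ ordinary_double_point f p ->
  hessian_discriminant f.
Proof.
case=> f0 f3 sing; apply: nonordinary_hessian_discriminant sing f0 => //.
by rewrite Num.Theory.pnatr_eq0.
Qed.
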